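(* Let $G$ be a finitely generated nilpotent group and let $M \subseteq G$ be a submonoid of $G$. If the set $MG' = \{mg \mid m \in M,\ g \in G'\}$ is a finite index subgroup of $G$, then $M$ itself is a finite index subgroup of $G$.
   Context: $G' = [G,G]$ denotes the commutator subgroup of $G$. A submonoid of $G$ is a subset containing the identity $e_G$ and closed under multiplication; it is not assumed to be closed under inverses. ''Is a finite index subgroup'' means that the set is a subgroup (in particular closed under inverses) and has finite index in $G$. *)

(* Defs.v *)
(* MathComp, with the abstract groups of boot/monoid.v; subsets are the
   Prop-valued sets of mathcomp.classical. *)
From mathcomp Require Import all_boot.
From mathcomp Require Import boolp classical_sets functions cardinality.

Set Implicit Arguments.
Unset Strict Implicit.
Unset Printing Implicit Defensive.

Local Open Scope classical_set_scope.
Local Open Scope group_scope.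

Definition submonoid (G : groupType) (M : set G) : Prop :=
  monoid_closed [in M].

Definition subgroup (G : groupType) (H : set G) : Prop :=
  group_closed [in H].

Lemma submonoidP (G : groupType) (M : set G) :
  submonoid M <-> M 1 /\ (forall x y, M x -> M y -> M (x * y)).
Proof.
rewrite /submonoid; split=> [[/set_mem M1 MM]|[M1 MM]]; split.
- exact: M1.
- by move=> x y Mx My; apply/set_mem/MM; apply: mem_set.
- exact: mem_set.
- by move=> x y /set_mem Mx /set_mem My; apply/mem_set/MM.
Qed.

Lemma subgroupP (G : groupType) (H : set G) :
  subgroup H <->
  [/\ H 1, forall x y, H x -> H y -> H (x * y) & forall x, H x -> H x^-1].
Proof.
rewrite /subgroup; split=> [HH|[H1 HM HV]].
- have HV := group_closedV HH; have HM := group_closedM HH.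
  case: HH => /set_mem H1 _; split=> //.
  + by move=> x y Hx Hy; apply/set_mem/HM; apply: mem_set.
  + by move=> x Hx; apply/set_mem/HV; apply: mem_set.
- split; first exact: mem_set.
  by move=> x y /set_mem Hx /set_mem Hy; apply/mem_set/HM => //; apply: HV.
Qed.

(* The set of left cosets of H in G is finite. *)
Definition finite_index (G : groupType) (H : set G) : Prop :=
  finite_set [set [set x * h | h in H] | x in [set: G]].

Definition finite_index_subgroup (G : groupType) (H : set G) : Prop :=
  subgroup H /\ finite_index H.

Definition generated (G : groupType) (S : set G) : set G :=
  smallest (@subgroup G) S.

Definition finitely_generated (G : groupType) : Prop :=
  exists S : set G, finite_set S /\ generated S = [set: G].

(* The subgroup [A, B] generated by the commutators, not just their set. *)
Definition commutator (G : groupType) (A B : set G) : set G :=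
  generated [set [~ a, b] | a in A & b in B].

Definition derived_subgroup (G : groupType) : set G :=
  commutator [set: G] [set: G].
Arguments derived_subgroup : clear implicits.

(* Indexed from 0: the n-th term is usually written gamma_(n+1)(G). *)
Definition lower_central_series (G : groupType) (n : nat) : set G :=
  iter n (fun A => commutator A [set: G]) [set: G].
Arguments lower_central_series : clear implicits.

Definition nilpotent (G : groupType) : Prop :=
  exists n, lower_central_series G n = [set 1].

(* Main.v *)
(* Write gamma_i for the lower central series. From [M gamma_i] of finite index
   one passes to [M gamma_(i+1)] by working in [G / gamma_(i+1)], where the image
   Z of gamma_i is central and generated by finitely many commutators. Some power
   t of each of them equals [m, n] with m, n in M; as m and n are invertible in M
   up to central factors x and y, the element t^(+-N^2) (x y)^N lies in M for all
   N: the quadratic term wins, so the closed cone spanned by M in Z contains t and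
   t^-1. Collecting the linear corrections of all generators into a single U in
   Z, the same estimate applied to U^-1 itself gives U^-1 in M, and then every
   element of Z has a positive power in M. *)
From HB Require Import structures.
Require Import Defs.
From mathcomp Require Import all_boot zify.
From mathcomp Require Import boolp classical_sets functions cardinality.

Local Open Scope classical_set_scope.
Local Open Scope quotient_scope.
Local Open Scope group_scope.

Set Implicit Arguments.
Unset Strict Implicit.
Unset Printing Implicit Defensive.

(** * Generated subgroups and finite index *)

Lemma sub_generated (G : groupType) (S : set G) : S `<=` generated S.
Proof. exact: sub_gen_smallest. Qed.

Lemma generated_sub (G : groupType) (S H : set G) :
  subgroup H -> S `<=` H -> generated S `<=` H.
Proof. exact: smallest_sub. Qed.

Lemma generated_subgroup (G : groupType) (S : set G) : subgroup (generated S).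
Proof.
apply/subgroupP; split.
- by move=> A [/subgroupP[]].
- move=> x y Sx Sy A CA; have [/subgroupP[_ AM _] _] := CA.
  by apply: AM; [exact: Sx|exact: Sy].
- by move=> x Sx A CA; have [/subgroupP[_ _ AV] _] := CA; apply: AV; exact: Sx.
Qed.

Lemma submonoidX (G : groupType) (M : set G) x n :
  submonoid M -> M x -> M (x ^+ n).
Proof.
move=> /submonoidP[M1 MM] Mx; elim: n => [|n IHn]; first exact: M1.
by rewrite expgS; apply: MM.
Qed.

Lemma subgroup_submonoid (G : groupType) (H : set G) :
  subgroup H -> submonoid H.
Proof. by move=> /subgroupP[H1 HM _]; apply/submonoidP. Qed.

Lemma finite_indexP (G : groupType) (H : set G) : subgroup H ->
  finite_index H <->
  exists s : seq G, forall x, exists2 r, r \in s & H (r^-1 * x).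
Proof.
move=> /subgroupP[H1 HM HV]; split=> [fH|[s sP]].
(* [xget 1] picks one element from each coset; the default 1 is harmless because every coset is
   nonempty. *)
- have /finite_seqP[s sE] := finite_image (xget 1) fH.
  exists s => x; pose C := [set x * h | h in H].
  exists (xget 1 C).
  + have : [set` s] (xget 1 C) by rewrite -sE; exists C => //; exists x.
    by [].
  + have [h Hh <-] : C (xget 1 C)
      by apply: (@xgetPex _ 1 C); exists x, 1; rewrite ?mulg1.
    by rewrite invgM mulgVK; apply: HV.
- apply: sub_finite_set (finite_image (fun x => [set x * h | h in H])
    (finite_seq s)) => _ [x _ <-].
  have [r rs Hrx] := sP x; exists r => //.
  apply/seteqP; split=> _ [h Hh <-].
  + exists ((r^-1 * x)^-1 * h); first by apply: HM => //; apply: HV.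
    by rewrite invgM invgK -!mulgA mulVKg.
  + exists (r^-1 * x * h); first exact: HM.
    by rewrite !mulgA mulgV mul1g.
Qed.

(** Pigeonhole: among the [size s + 1] powers x^0, x^1, ... two share a coset representative, and
    their quotient x^(j - i) lies in H. *)
Lemma finite_index_expg (G : groupType) (H : set G) x :
  finite_index_subgroup H -> exists2 r, 0 < r & H (x ^+ r).
Proof.
move=> [sH /(finite_indexP sH)[s sP]]; have /subgroupP[H1 HM HV] := sH.
have /choice[f fP] : forall n, exists r, r \in s /\ H (r^-1 * x ^+ n).
  by move=> n; have [r] := sP (x ^+ n); exists r.
have : ~~ uniq [seq f n | n <- iota 0 (size s).+1].
  apply: contraTN isT => u.
  have := uniq_leq_size u (_ : {subset _ <= s}).
  rewrite size_map size_iota ltnn; apply.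
  by move=> _ /mapP[n _ ->]; have [] := fP n.
case/(uniqPn 1) => i [j [ij]]; rewrite size_map size_iota => jn.
rewrite !(nth_map 0) ?size_iota ?(ltn_trans ij) //.
rewrite !nth_iota ?(ltn_trans ij) // !add0n => fij.
exists (j - i); first by rewrite subn_gt0.
have [[_ Hi] [_ Hj]] := (fP i, fP j); rewrite fij in Hi.
have := HM _ _ (HV _ Hi) Hj.
rewrite invgM invgK mulgA mulgK -{1}(subnKC (ltnW ij)) expgnDr.
by rewrite mulKg.
Qed.

(** * Central elements and powers of commutators *)

Definition central (G : groupType) (z : G) := forall x, commute z x.

Lemma central1 (G : groupType) : central (1 : G).
Proof. by move=> x; apply/commute_sym/commute1. Qed.

Lemma centralM (G : groupType) (y z : G) :
  central y -> central z -> central (y * z).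
Proof. by move=> cy cz x; apply/commute_sym/commuteM; apply/commute_sym. Qed.

Lemma centralV (G : groupType) (z : G) : central z -> central z^-1.
Proof. by move=> cz x; apply/commute_sym/commuteV/commute_sym. Qed.

Lemma centralX (G : groupType) (z : G) n : central z -> central (z ^+ n).
Proof. by move=> cz x; apply/commute_sym/commuteX/commute_sym. Qed.

Lemma commg_centralMl (G : groupType) (x y z : G) :
  central z -> [~ x * z, y] = [~ x, y].
Proof.
move=> cz; rewrite /commg /conjg invgM -!mulgA (cz y) (centralV cz).
by rewrite -!mulgA mulgV mulg1.
Qed.

Lemma commg_centralMr (G : groupType) (x y z : G) :
  central z -> [~ x, y * z] = [~ x, y].
Proof. by move=> cz; rewrite -invgR commg_centralMl // invgR. Qed.

(** When [x, y] is central, y^x is the product of the commuting factors y and [x, y]^-1, so its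
    powers can be taken factor by factor. *)
Lemma commgX_central (G : groupType) (x y : G) n :
  central [~ x, y] -> [~ x, y ^+ n] = [~ x, y] ^+ n.
Proof.
move=> cxy; have yx : y ^ x = y * [~ x, y]^-1.
  by rewrite invgR /commg mulVKg.
rewrite -invgR /commg conjXg yx expgMn; last exact/commute_sym/centralV.
by rewrite mulKg expVgn invgK.
Qed.

Lemma commXg_central (G : groupType) (x y : G) n :
  central [~ x, y] -> [~ x ^+ n, y] = [~ x, y] ^+ n.
Proof.
move=> cxy; rewrite -invgR commgX_central -?expVgn ?invgR //.
by rewrite -invgR; apply: centralV.
Qed.

Lemma commXX_central (G : groupType) (x y : G) m n :
  central [~ x, y] -> [~ x ^+ m, y ^+ n] = [~ x, y] ^+ (m * n).
Proof.
move=> cxy; rewrite commgX_central commXg_central ?expgnA //.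
exact: centralX.
Qed.

(** Since [m, n]^(N^2) = [m^N, n^N] = m^-N n^-N m^N n^N, the central factors x^N and y^N can be
    moved next to m^-N and n^-N. This turns the two inverses into powers of elements of M: a
    quadratic exponent is bought with a linear correction. *)
Lemma commg_powers_in_submonoid (G : groupType) (M : set G) (m n x y : G) N :
  submonoid M -> M m -> M n -> M (m^-1 * x) -> M (n^-1 * y) ->
  central x -> central y -> central [~ m, n] ->
  M ([~ m, n] ^+ (N * N) * (x * y) ^+ N).
Proof.
move=> sM Mm Mn Mx My cx cy cmn.
have /submonoidP[_ MM] := sM.
suff -> : [~ m, n] ^+ (N * N) * (x * y) ^+ N =
    (m^-1 * x) ^+ N * (n^-1 * y) ^+ N * (m ^+ N * n ^+ N).
  by apply: (MM); apply: (MM); exact: submonoidX.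
have cxN := centralX N cx; have cyN := centralX N cy.
rewrite -commXX_central // /commg /conjg (expgMn _ (cx y)).
rewrite (expgMn _ (commute_sym (cx m^-1))) (expgMn _ (commute_sym (cy n^-1))).
rewrite !expVgn -!mulgA; congr (_ * _).
rewrite (cxN (n ^- N * _)) -!mulgA; congr (_ * _).
by rewrite (cyN (_ * _)) -!mulgA (cxN (y ^+ N)).
Qed.

(* The error term U is only linear in N, against a main term quadratic in N. *)
Definition asymptotically_in (G : groupType) (M : set G) (U z : G) : Prop :=
  central z /\ exists r a, 0 < r /\ forall N,
    M (z ^+ (r * N * N) * U ^+ (a * N)) /\
    M (z^-1 ^+ (r * N * N) * U ^+ (a * N)).

(** * Elements lying in a submonoid up to a linear error *)

Section AsymptoticallyIn.
Variables (G : groupType) (M : set G) (U : G).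
Hypotheses (sM : submonoid M) (cU : central U).

Lemma asymptotically_inM y z :
  asymptotically_in M U y -> asymptotically_in M U z ->
  asymptotically_in M U (y * z).
Proof.
(* Taking the s-th power of one witness and the r-th power of the other gives both the quadratic
   coefficient rs; the linear coefficients become as and br, and add up. *)
have eqM x t r s a b N : central x -> central t ->
    (x * t) ^+ (r * s * N * N) * U ^+ ((a * s + b * r) * N) =
    (x ^+ (r * N * N) * U ^+ (a * N)) ^+ s *
    (t ^+ (s * N * N) * U ^+ (b * N)) ^+ r.
  move=> cx ct; rewrite !expgMn -?expgnA //; try exact: centralX.
  rewrite mulnDl expgnDr -!mulgA.
  rewrite (mulgA (U ^+ _) (t ^+ _)) (centralX _ cU (t ^+ _)) -!mulgA.
  by congr (_ ^+ _ * (_ ^+ _ * (_ ^+ _ * _ ^+ _))); nia.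
have /submonoidP[_ MM] := sM.
move=> [cy [r [a [r0 ya]]]] [cz [s [b [s0 zb]]]]; split; first exact: centralM.
exists (r * s)%N, (a * s + b * r)%N; split; first by rewrite muln_gt0 r0.
move=> N; have [[y1 y2] [z1 z2]] := (ya N, zb N).
rewrite invgM -(centralV cy) !eqM //; try exact: centralV.
by split; apply: MM; apply: submonoidX.
Qed.

Lemma asymptotically_in_subgroup : subgroup (asymptotically_in M U).
Proof.
have /submonoidP[M1 MM] := sM.
apply/subgroupP; split.
- split; first exact: central1.
  exists 1%N, 0%N; split=> // N.
  by rewrite invg1 expg1n mul0n expg0 mul1g.
- exact: asymptotically_inM.
- move=> z [cz [r [a [r0 za]]]]; split; first exact: centralV.
  exists r, a; split=> // N; have [z1 z2] := za N.
  by rewrite invgK.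
Qed.

(** Multiplying by V^(aN), an element of M, enlarges the error term; this lets several elements
    share a single one. *)
Lemma asymptotically_in_mulr V z : central V -> M V ->
  asymptotically_in M U z -> asymptotically_in M (U * V) z.
Proof.
move=> cV MV [cz [r [a [r0 za]]]]; split=> //; exists r, a; split=> // N.
have [z1 z2] := za N; have /submonoidP[_ MM] := sM.
rewrite expgMn; last exact: cU.
by rewrite !mulgA; split; apply: MM => //; apply: submonoidX.
Qed.

Lemma asymptotically_in_root z n : central z -> 0 < n ->
  asymptotically_in M U (z ^+ n) -> asymptotically_in M U z.
Proof.
move=> cz n0 [_ [r [a [r0 za]]]]; split=> //; exists (n * r)%N, a.
split=> [|N]; first by rewrite muln_gt0 n0.
have := za N; rewrite -expVgn -!expgnA.
by have -> : (n * (r * N * N) = n * r * N * N)%N by nia.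
Qed.

(** The inverse is z^-n z^(n-1), a product of two elements of M. *)
Lemma inv_in_submonoid z n : 0 < n -> M z -> M (z^-1 ^+ n) -> M z^-1.
Proof.
case: n => // n _ Mz; rewrite expgS => Mzn.
have /submonoidP[_ MM] := sM.
have := MM _ _ Mzn (submonoidX n sM Mz).
by rewrite expVgn mulgVK.
Qed.

(* Taking N = a + 1 in U^(-rN^2) U^(aN) makes the exponent negative. *)
Lemma asymptotically_in_self : M U -> asymptotically_in M U U -> M U^-1.
Proof.
move=> MU [_ [r [a [r0 Ua]]]]; have [_ MUa] := Ua a.+1.
have n0 : 0 < r * a.+1 * a.+1 - a * a.+1 by nia.
apply: (inv_in_submonoid n0) => //.
by rewrite expgnFr ?(expVgn U (a * a.+1)) ?invgK //; nia.
Qed.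

(** At N = 1 the element z^-r U^a is in M, and U^-a removes the error. *)
Lemma asymptotically_in_expg z : M U^-1 -> asymptotically_in M U z ->
  exists2 r, 0 < r & M (z^-1 ^+ r).
Proof.
move=> MU [_ [r [a [r0 za]]]]; exists r => //.
have [_] := za 1%N; rewrite !muln1 => Mz.
have /submonoidP[_ MM] := sM.
have := MM _ _ Mz (submonoidX a sM MU).
by rewrite (expVgn U) mulgK.
Qed.

End AsymptoticallyIn.

(** * Finite extensions by central elements *)

Lemma finite_extension1 (G : groupType) (H : set G) (t : G) r :
  subgroup H -> central t -> 0 < r -> H (t ^+ r) ->
  subgroup [set x | exists n, H (t ^- n * x)] /\
  forall x n, H (t ^- n * x) -> exists2 i, i < r & H (t ^- i * x).
Proof.
move=> sH ct r0 Htr; have /subgroupP[H1 HM HV] := sH.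
have ctV n : central (t ^- n) by apply/centralV/centralX.
(* This set is the product of H with the powers of t; nonnegative exponents suffice because t^r is
   in H. *)
split.
- apply/subgroupP; split.
  + by exists 0%N; rewrite invg1 mulg1.
  + move=> x y [m Hx] [n Hy]; exists (n + m)%N.
    have := HM _ _ Hx Hy.
    by rewrite expgnDr invgM -!mulgA (mulgA x) -(ctV n x) -!mulgA.
  (* As t is central, t^(n - rn) x^-1 is the product of t^(-rn) and (t^-n x)^-1, both in H. *)
  + move=> x [n Hx]; exists (r * n - n)%N.
    rewrite -(expVgn t) expgnFr; last by nia.
    rewrite !expVgn invgK expgnA.
    have := HM _ _ (HV _ (submonoidX n (subgroup_submonoid sH) Htr)) (HV _ Hx).
    by rewrite invgM invgK -!mulgA (centralX n ct).
- move=> x n Hx; exists (n %% r); first by rewrite ltn_mod.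
  have := HM _ _ (submonoidX (n %/ r) (subgroup_submonoid sH) Htr) Hx.
  rewrite -expgnA mulgA {2}(divn_eq n r) (mulnC r) expgnDr invgM.
  by rewrite (ctV (n %% r)) mulgA mulgV mul1g.
Qed.

(** The elements of [ts] are adjoined one at a time; each t enlarges the list of representatives
    only by the factors t^i with i < r. *)
Lemma finite_extension (G : groupType) (M : set G) (ts : seq G) :
  subgroup M ->
  (forall t, t \in ts -> central t /\ exists2 r, 0 < r & M (t ^+ r)) ->
  exists H (s : seq G), [/\ subgroup H, M `<=` H, [set` ts] `<=` H &
    forall h, H h -> exists2 k, k \in s & M (k^-1 * h)].
Proof.
move=> sM; elim: ts => [|t ts IHts] tsP.
  exists M, [:: 1]; split=> // h Mh; exists 1; first exact: mem_head.
  by rewrite invg1 mul1g.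
have [|H [s [sH MH tsH Hs]]] := IHts.
  by move=> u uts; apply: tsP; rewrite in_cons uts orbT.
have [ct [r r0 Mtr]] := tsP t (mem_head _ _).
have [sH' H'r] := finite_extension1 sH ct r0 (MH _ Mtr).
have HH' : H `<=` [set x | exists n, H (t ^- n * x)].
  by move=> x Hx; exists 0%N; rewrite invg1 mul1g.
exists [set x | exists n, H (t ^- n * x)].
exists [seq t ^+ i * k | i <- iota 0 r, k <- s]; split=> //.
- exact: subset_trans HH'.
- move=> u /=; rewrite in_cons => /orP[/eqP ->|/tsH/HH' //].
  exists 1%N; rewrite expg1 mulVg.
  by have /subgroupP[] := sH.
- move=> h [n /H'r[i ir Hh]]; have [k ks Mk] := Hs _ Hh.
  exists (t ^+ i * k); first by apply: allpairs_f => //; rewrite mem_iota.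
  by rewrite invgM -mulgA.
Qed.

(** * Removing a central subgroup Z from MZ *)

Section CentralStep.
Variables (G : groupType) (M Z : set G).
Hypotheses (sM : submonoid M) (sZ : subgroup Z).
Hypothesis cZ : forall z, Z z -> central z.
Hypothesis fK : finite_index_subgroup [set m * z | m in M & z in Z].

Let M1 : M 1. Proof. by have /submonoidP[] := sM. Qed.
Let MM x y : M x -> M y -> M (x * y).
Proof. by have /submonoidP[_] := sM; apply. Qed.
Let Z1 : Z 1. Proof. by have /subgroupP[] := sZ. Qed.
Let ZM x y : Z x -> Z y -> Z (x * y).
Proof. by have /subgroupP[_ ZM _] := sZ; apply: ZM. Qed.
Let ZV x : Z x -> Z x^-1.
Proof. by have /subgroupP[_ _ ZV] := sZ; apply: ZV. Qed.

(** As MZ is a group, m^-1 = m' z with m' in M, and x = z^-1 works. *)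
Lemma inverse_up_to_central m : M m -> exists2 x, Z x & M (m^-1 * x).
Proof.
move=> Mm; have /subgroupP[_ _ KV] := fK.1.
have [m' Mm' [z Zz zE]] : [set m * z | m in M & z in Z] m^-1.
  by apply: KV; exists m => //; exists 1; rewrite ?mulg1.
by exists z^-1; [exact: ZV|rewrite -zE mulgK].
Qed.

(** Powers a^r and b^s fall into MZ, and dropping their central parts does not change commutators.
    Hence [a, b]^(rs) = [m, n] with m, n in M, to which the quadratic estimate applies. *)
Lemma commg_asymptotically_in a b : Z [~ a, b] ->
  exists2 u, M u /\ Z u & asymptotically_in M u [~ a, b].
Proof.
move=> Zab; have cab := cZ Zab.
have [r r0 [m Mm [z Zz mE]]] := finite_index_expg a fK.
have [s s0 [n Mn [w Zw nE]]] := finite_index_expg b fK.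
have [x Zx Mx] := inverse_up_to_central Mm.
have [y Zy My] := inverse_up_to_central Mn.
have tE : [~ a, b] ^+ (r * s) = [~ m, n].
  rewrite -commXX_central // -mE -nE commg_centralMl; last exact: cZ.
  by rewrite commg_centralMr //; apply: cZ.
have cmn : central [~ m, n] by rewrite -tE; apply: centralX.
have cnm : central [~ n, m] by rewrite -invgR; apply: centralV.
exists (x * y).
  split; last exact: ZM.
  by have := MM (MM Mm Mx) (MM Mn My); rewrite !mulVKg.
apply: (@asymptotically_in_root _ _ _ _ (r * s)%N) => //.
  by rewrite muln_gt0 r0.
rewrite tE; split=> //; exists 1%N, 1%N; split=> // N; rewrite !mul1n; split.
  by apply: commg_powers_in_submonoid => //; exact: cZ.
(* The inverse of [m, n] is [n, m]: exchanging m and n gives the negative powers with the same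
   error, as x and y commute. *)
rewrite invgR (cZ Zx y).
by apply: commg_powers_in_submonoid => //; exact: cZ.
Qed.

(** The common error term U is the product of the error terms of the individual commutators. *)
Lemma commgs_asymptotically_in (l : seq (G * G)) :
  (forall p, p \in l -> Z [~ p.1, p.2]) ->
  exists2 U, M U /\ Z U &
    forall p, p \in l -> asymptotically_in M U [~ p.1, p.2].
Proof.
elim: l => [|p l IHl] Zl; first by exists 1.
have [|U [MU ZU] UP] := IHl.
  by move=> q ql; apply: Zl; rewrite in_cons ql orbT.
have [u [Mu Zu] uP] := commg_asymptotically_in (Zl p (mem_head _ _)).
exists (U * u); first by split; [exact: MM|exact: ZM].
move=> q; rewrite in_cons => /orP[/eqP ->|ql].
  rewrite (cZ ZU u).
  by apply: asymptotically_in_mulr => //; exact: cZ.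
by apply: asymptotically_in_mulr; [..|exact: UP] => //; exact: cZ.
Qed.

Lemma finite_index_subgroup_central_step (l : seq (G * G)) :
  (forall p, p \in l -> Z [~ p.1, p.2]) ->
  Z `<=` generated [set [~ p.1, p.2] | p in [set` l]] ->
  finite_index_subgroup M.
Proof.
move=> Zl lZ; have [U [MU ZU] UP] := commgs_asymptotically_in Zl.
(* The elements asymptotically in M form a subgroup, so checking the generators of Z is enough.
   Since U is in Z, the estimate then applies to U itself. *)
have ZY : Z `<=` asymptotically_in M U.
  apply: subset_trans lZ _; apply: generated_sub.
    exact: asymptotically_in_subgroup (cZ ZU).
  by move=> _ [p pl <-]; apply: UP.
have MUV := asymptotically_in_self sM MU (ZY _ ZU).
have ZX z : Z z -> exists2 r, 0 < r & M (z^-1 ^+ r).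
  by move=> /ZY; apply: asymptotically_in_expg.
(* Write m^-1 = (m^-1 x) x^-1. Here x = m (m^-1 x) is in M, and so is some x^-r with r > 0; hence
   x^-1 is in M. *)
have gM : subgroup M.
  apply/subgroupP; split=> // m Mm.
  have [x Zx Mx] := inverse_up_to_central Mm.
  have Mx' : M x by have := MM Mm Mx; rewrite mulVKg.
  have [r r0 Mr] := ZX x Zx.
  by have := MM Mx (inv_in_submonoid sM r0 Mx' Mr); rewrite mulgK.
split=> //.
(* Adjoining the generators of Z to M gives a group H containing MZ in which M has finite index.
   Representatives of G modulo MZ times those of H modulo M then represent G modulo M. *)
have [|H [s [sH MH lH Hs]]] :=
    finite_extension (ts := [seq [~ p.1, p.2] | p <- l]) gM.
  move=> _ /mapP[p pl ->]; split; first exact/cZ/Zl.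
  by have [r r0] := ZX _ (ZV (Zl p pl)); rewrite invgK => Mr; exists r.
have /subgroupP[_ HM _] := sH.
have KH : [set m * z | m in M & z in Z] `<=` H.
  move=> _ [m Mm [z Zz <-]]; apply: HM; first exact: MH.
  apply: (generated_sub sH _ (lZ _ Zz)) => _ [p pl <-].
  by apply: lH; apply/mapP; exists p.
have [sK /(finite_indexP sK)[ks ksP]] := fK.
apply/(finite_indexP gM); exists [seq k * h | k <- ks, h <- s] => x.
have [k kks /KH/Hs[h hs Mh]] := ksP x.
exists (k * h); first exact: allpairs_f.
by rewrite invgM -mulgA.
Qed.

End CentralStep.

(** * Quotient by a normal subgroup *)

Definition normal_in (G : groupType) (N : set G) : Prop :=
  subgroup N /\ forall x y, N x -> N (x ^ y).

Section Quotient.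
Variables (G : groupType) (N : set G).
Hypothesis nN : normal_in N.

Let N1 : N 1. Proof. by have /subgroupP[] := nN.1. Qed.
Let NM x y : N x -> N y -> N (x * y).
Proof. by have /subgroupP[_ NM _] := nN.1; apply: NM. Qed.
Let NV x : N x -> N x^-1.
Proof. by have /subgroupP[_ _ NV] := nN.1; apply: NV. Qed.

Let coset_rel (x y : G) := `[< N (x^-1 * y) >].

Let coset_rel_refl : reflexive coset_rel.
Proof. by move=> x; apply/asboolP; rewrite mulVg. Qed.

Let coset_rel_sym : symmetric coset_rel.
Proof.
by move=> x y; apply/asboolP/asboolP => /NV; rewrite invgM invgK.
Qed.

Let coset_rel_trans : transitive coset_rel.
Proof.
move=> y x z /asboolP Nxy /asboolP Nyz; apply/asboolP.
by have := NM Nxy Nyz; rewrite -mulgA mulVKg.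
Qed.

Let coset_equiv :=
  EquivRel coset_rel coset_rel_refl coset_rel_sym coset_rel_trans.
Let quotient := {eq_quot coset_equiv}.
Let proj (x : G) : quotient := \pi_quotient x.

Let projP x y : proj x = proj y <-> N (x^-1 * y).
Proof.
split=> [/eqmodP/asboolP //|Nxy].
exact/eqmodP/asboolP.
Qed.

Let qmul (u v : quotient) := proj (repr u * repr v).
Let qinv (u : quotient) := proj (repr u)^-1.

Let reprP x : N (x^-1 * repr (proj x)).
Proof. by apply/projP; rewrite /proj reprK. Qed.

Let projM x y : qmul (proj x) (proj y) = proj (x * y).
Proof.
(* Normality enters here: moving the discrepancy between x and its representative past y conjugates
   it by y. *)
apply/esym/projP; have Nx := nN.2 _ y (reprP x); have Ny := reprP y.
have := NM Nx Ny; rewrite /conjg invgM -!mulgA.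
by rewrite (mulgA y y^-1) mulgV mul1g.
Qed.

Let projV x : qinv (proj x) = proj x^-1.
Proof.
apply/esym/projP; rewrite invgK.
have := nN.2 _ x^-1 (NV (reprP x)).
by rewrite /conjg invgM !invgK -mulgA mulgV mulg1.
Qed.

Let projE u : exists x, u = proj x.
Proof. by exists (repr u); rewrite /proj reprK. Qed.

Let qmulA : associative qmul.
Proof.
move=> u v w.
have [[x ->] [[y ->] [z ->]]] := conj (projE u) (conj (projE v) (projE w)).
by rewrite !projM mulgA.
Qed.
Let qmul1 : left_id (proj 1) qmul.
Proof. by move=> u; have [x ->] := projE u; rewrite projM mul1g. Qed.
Let qmul1r : right_id (proj 1) qmul.
Proof. by move=> u; have [x ->] := projE u; rewrite projM mulg1. Qed.
Let qmulV : left_inverse (proj 1) qinv qmul.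
Proof. by move=> u; have [x ->] := projE u; rewrite projV projM mulVg. Qed.
Let qmulVr : right_inverse (proj 1) qinv qmul.
Proof. by move=> u; have [x ->] := projE u; rewrite projV projM mulgV. Qed.

HB.instance Definition _ := Choice.on quotient.
HB.instance Definition _ :=
  isGroup.Build quotient qmulA qmul1 qmul1r qmulV qmulVr.

Let proj_morph : {morph proj : x y / x / y}.
Proof. by move=> x y; rewrite -projM -projV. Qed.
HB.instance Definition _ := isGroupMorphism.Build G quotient proj proj_morph.

(** Only a surjective morphism with kernel N is exported, so later arguments do not depend on how
    cosets are represented. *)
Lemma quotient_exists : exists (Q : groupType) (f : UMagmaMorphism.type G Q),
  (forall u, exists x, f x = u) /\ (forall x, f x = 1 <-> N x).
Proof.
exists quotient, proj; split=> [u|x].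
- by have [x ->] := projE u; exists x.
- split=> [fx|Nx].
  + have : N (1^-1 * x) by apply/projP; rewrite fx.
    by rewrite invg1 mul1g.
  + by apply/esym/projP; rewrite invg1 mul1g.
Qed.

End Quotient.

(** * Images and preimages under group morphisms *)

Section Morphism.
Variables (G Q : groupType) (f : UMagmaMorphism.type G Q).

Lemma subgroup_image (H : set G) : subgroup H -> subgroup (f @` H).
Proof.
move=> /subgroupP[H1 HM HV]; apply/subgroupP; split.
- by exists 1; rewrite ?gmulf1.
- by move=> _ _ [x Hx <-] [y Hy <-]; exists (x * y); [exact: HM|rewrite gmulfM].
- by move=> _ [x Hx <-]; exists x^-1; [exact: HV|rewrite gmulfV].
Qed.

Lemma submonoid_image (M : set G) : submonoid M -> submonoid (f @` M).
Proof.
move=> /submonoidP[M1 MM]; apply/submonoidP; split.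
- by exists 1; rewrite ?gmulf1.
- by move=> _ _ [x Mx <-] [y My <-]; exists (x * y); [exact: MM|rewrite gmulfM].
Qed.

Lemma subgroup_preimage (H : set Q) : subgroup H -> subgroup (f @^-1` H).
Proof.
move=> /subgroupP[H1 HM HV]; apply/subgroupP; split; rewrite /preimage /=.
- by rewrite gmulf1.
- by move=> x y Hx Hy; rewrite gmulfM; apply: HM.
- by move=> x Hx; rewrite gmulfV; apply: HV.
Qed.

Hypothesis f_surj : forall u, exists x, f x = u.

Lemma finite_index_image (H : set G) :
  finite_index_subgroup H -> finite_index_subgroup (f @` H).
Proof.
move=> [sH /(finite_indexP sH)[s sP]]; have sfH := subgroup_image sH.
split=> //; apply/(finite_indexP sfH); exists (map f s) => u.
have [x <-] := f_surj u; have [r rs Hr] := sP x.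
exists (f r); first exact: map_f.
by exists (r^-1 * x); rewrite // gmulfM gmulfV.
Qed.

Lemma finite_index_preimage (H : set Q) :
  finite_index_subgroup H -> finite_index_subgroup (f @^-1` H).
Proof.
move=> [sH /(finite_indexP sH)[s sP]]; have sfH := subgroup_preimage sH.
have [g gK] := choice f_surj.
split=> //; apply/(finite_indexP sfH); exists (map g s) => x.
have [r rs Hr] := sP (f x); exists (g r); first exact: map_f.
by rewrite /preimage /= gmulfM gmulfV gK.
Qed.

End Morphism.

(** * Commutator subgroups and their generators *)

Lemma mem_commutator (G : groupType) (A : set G) a g :
  A a -> commutator A [set: G] [~ a, g].
Proof. by move=> Aa; apply: sub_generated; exists a => //; exists g. Qed.

(** The elements all of whose conjugates stay in [A, G] form a subgroup; it contains the generators
    because [a, g]^z = [a^z, g^z]. *)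
Lemma commutator_normal (G : groupType) (A : set G) :
  normal_in A -> normal_in (commutator A [set: G]).
Proof.
move=> nA; have sB : subgroup (commutator A [set: G]) := generated_subgroup _.
split=> // x y Bx; have /subgroupP[B1 BM BV] := sB.
suff : commutator A [set: G] `<=`
    [set x | forall y, commutator A [set: G] (x ^ y)] by apply.
apply: generated_sub.
- apply/subgroupP; split=> [z|u v Bu Bv z|u Bu z].
  + by rewrite conj1g.
  + by rewrite conjMg; apply: BM.
  + by rewrite conjVg; apply: BV.
- move=> _ [a Aa [g _ <-]] z; rewrite conjRg.
  by apply: mem_commutator; apply: nA.2.
Qed.

Lemma commutator_sub (G : groupType) (A : set G) :
  normal_in A -> commutator A [set: G] `<=` A.
Proof.
move=> [sA AJ]; have /subgroupP[_ AM AV] := sA.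
apply: generated_sub => // _ [a Aa [g _ <-]].
by apply: AM; [exact: AV|exact: AJ].
Qed.

(** Modulo C = [B, G] the commutator is multiplicative in each argument and trivial on B, so
    generators of A modulo B and generators of G are enough. *)
Lemma commutator_generators (G : groupType) (A : set G) (X S : seq G) :
  let B := commutator A [set: G] in
  normal_in A -> [set` X] `<=` A -> A `<=` generated ([set` X] `|` B) ->
  generated [set` S] = [set: G] ->
  B `<=` generated ([set [~ x, s] | x in [set` X] & s in [set` S]] `|`
    commutator B [set: G]).
Proof.
move=> B nA XA AX SG; set C := commutator B _; set W := generated _.
have sW : subgroup W := generated_subgroup _.
have /subgroupP[W1 WM WV] := sW.
have sB : subgroup B := generated_subgroup _.
have CW : C `<=` W by move=> c Cc; apply: sub_generated; right.
have CB : C `<=` B := commutator_sub (commutator_normal nA).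
have WB : W `<=` B.
  apply: generated_sub => // _ [[x Xx [s _ <-]]|/CB //].
  exact: mem_commutator (XA _ Xx).
(* W is normal: w^g = w [w, g], and [w, g] is in C because W is contained in B. *)
have WJ w g : W w -> W (w ^ g).
  move=> Ww; have -> : w ^ g = w * [~ w, g] by rewrite /commg mulVKg.
  by apply: WM => //; apply: CW; apply: mem_commutator; exact: WB.
(* For fixed x, the g with [x, g] in W form a subgroup containing S. *)
have XW x g : x \in X -> W [~ x, g].
  move=> Xx; have : [set: G] g by [].
  rewrite -SG; move: g; apply: generated_sub => [|s Ss].
    apply/subgroupP; split=> [|g h Wg Wh|g Wg] /=.
    - by rewrite commg1.
    - have -> : [~ x, g * h] = [~ x, h] * [~ x, g] ^ h.
        by rewrite /commg /conjg !invgM -!mulgA !mulVKg.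
      by apply: WM => //; apply: WJ.
    - have -> : [~ x, g^-1] = ([~ x, g]^-1) ^ g^-1.
        by rewrite /commg /conjg !invgM !invgK -!mulgA mulVKg.
      by apply: WJ; apply: WV.
  by apply: sub_generated; left; exists x => //; exists s.
(* Likewise, the a with [a, g] in W for every g form a subgroup; it contains X by the previous step
   and B because C lies in W. *)
have AW : A `<=` [set a | forall g, W [~ a, g]].
  apply: subset_trans AX _; apply: generated_sub => [|a [Xa|Ba] g].
  - apply/subgroupP; split=> [g|a b Wa Wb g|a Wa g].
    + by rewrite comm1g.
    + have -> : [~ a * b, g] = [~ a, g] ^ b * [~ b, g].
        by rewrite /commg /conjg !invgM -!mulgA !mulVKg.
      by apply: WM => //; apply: WJ.
    + have -> : [~ a^-1, g] = ([~ a, g]^-1) ^ a^-1.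
        by rewrite /commg /conjg !invgM !invgK -!mulgA mulgV mulg1.
      by apply: WJ; apply: WV.
  - exact: XW.
  - by apply: CW; apply: mem_commutator.
by apply: generated_sub => // _ [a Aa [g _ <-]]; apply: AW.
Qed.


(** * Descent along the lower central series *)

Section LowerCentralSeries.
Variable G : groupType.
Local Notation gamma := (lower_central_series G).

Lemma lower_central_series_normal n : normal_in (gamma n).
Proof.
elim: n => [|n]; last exact: commutator_normal.
by split=> //; apply/subgroupP.
Qed.

(** Commutators of generators of one factor with generators of G generate the next factor, so finite
    generation passes down the series. *)
Lemma lower_central_series_generators (S : seq G) n :
  generated [set` S] = [set: G] ->
  exists X : seq G, [set` X] `<=` gamma n /\
    gamma n `<=` generated ([set` X] `|` gamma n.+1).
Proof.
move=> SG; elim: n => [|n [X [Xn nX]]].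
  exists S; split=> //; rewrite (_ : gamma 0 = generated [set` S]) //.
  apply: generated_sub.
    exact: generated_subgroup.
  by move=> x Sx; apply: sub_generated; left.
exists [seq [~ x, s] | x <- X, s <- S]; split.
  by move=> _ /allpairsP[p [Xp _ ->]]; apply: mem_commutator; apply: Xn.
apply: subset_trans (commutator_generators (lower_central_series_normal n)
  Xn nX SG) _.
apply: generated_sub; first exact: generated_subgroup.
move=> y [[x Xx [s Ss <-]]|Cy]; apply: sub_generated; last by right.
by left; apply: allpairs_f.
Qed.

(** The central step is carried out in Q = G / [gamma n.+2]. The set M [gamma n.+2] is the full
    preimage of the image of M, so finite index comes back to G. *)
Lemma finite_index_lower_central_step (M : set G) n :
  finitely_generated G -> submonoid M ->
  finite_index_subgroup [set m * g | m in M & g in gamma n.+1] ->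
  finite_index_subgroup [set m * g | m in M & g in gamma n.+2].
Proof.
move=> [_ [/finite_seqP[S ->] SG]] sM fK.
have [X [Xn nX]] := lower_central_series_generators n SG.
have nn := lower_central_series_normal.
have [Q [f [f_surj f1]]] := quotient_exists (nn n.+2).
have -> : [set m * g | m in M & g in gamma n.+2] = f @^-1` (f @` M).
  apply/seteqP; split=> [_ [m Mm [g ng <-]]|x [m Mm fmx]].
    by exists m => //; rewrite gmulfM (iffRL (f1 g) ng) mulg1.
  exists m => //; exists (m^-1 * x); last by rewrite mulVKg.
  by apply/f1; rewrite gmulfM gmulfV fmx mulVg.
apply: finite_index_preimage => //.
apply: (@finite_index_subgroup_central_step _ _ (f @` gamma n.+1) _ _ _ _
  [seq (f x, f s) | x <- X, s <- S]).
- exact: submonoid_image.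
- exact/subgroup_image/(nn n.+1).1.
(* The image of [gamma n.+1] is central: its commutators with G lie in [gamma n.+2], the kernel of
   f. *)
- move=> _ [z nz <-] u; have [x <-] := f_surj u.
  apply/commgP/eqP; rewrite -gmulfR; apply/f1.
  exact: mem_commutator.
- have := finite_index_image f_surj fK; congr finite_index_subgroup.
  apply/seteqP; split.
    move=> _ [_ [m Mm [z nz <-]] <-]; exists (f m); first by exists m.
    by exists (f z); [exists z|rewrite gmulfM].
  move=> _ [_ [m Mm <-] [_ [z nz <-] <-]]; exists (m * z).
    by exists m => //; exists z.
  by rewrite gmulfM.
- move=> _ /allpairsP[p [Xp _ ->]] /=; exists [~ p.1, p.2].
    by apply: mem_commutator; apply: Xn.
  by rewrite gmulfR.
(* Modulo [gamma n.+2] the commutators [x, s] generate [gamma n.+1], and f kills the remaining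
   part. *)
- move=> _ [z nz <-].
  have := commutator_generators (nn n) Xn nX SG nz.
  move: z {nz}; apply: generated_sub.
    exact/subgroup_preimage/generated_subgroup.
  move=> y [[x Xx [s Ss <-]]|Cy].
    apply: sub_generated; exists (f x, f s); first exact: allpairs_f.
    by rewrite /= gmulfR.
  rewrite /preimage /= (iffRL (f1 y) Cy).
  by have /subgroupP[] := generated_subgroup
    [set [~ p.1, p.2] | p in [set` [seq (f x, f s) | x <- X, s <- S]]].
Qed.

End LowerCentralSeries.

Theorem theorem2 (G : groupType) (M : set G) :
  finitely_generated G ->
  nilpotent G ->
  submonoid M ->
  finite_index_subgroup [set m * g | m in M & g in derived_subgroup G] ->
  finite_index_subgroup M.
Proof.
move=> fgG [c c1] sM fMG'.
(* The base case n = 0 is the hypothesis, since [gamma 1] unfolds to the derived subgroup. *)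
have fM n : finite_index_subgroup
    [set m * g | m in M & g in lower_central_series G n.+1].
  elim: n => [//|n IHn]; exact: finite_index_lower_central_step.
(* The induction starts at index 1, so it is used one term past c; [gamma c.+1] is contained in
   [gamma c] and hence trivial too, which leaves M itself. *)
have := fM c; congr finite_index_subgroup.
have sub1 x : lower_central_series G c.+1 x -> x = 1.
  move=> /(commutator_sub (lower_central_series_normal G c)).
  by rewrite -/(lower_central_series G c) c1.
apply/seteqP; split=> [_ [m Mm [g /sub1 -> <-]]|m Mm]; first by rewrite mulg1.
exists m => //; exists 1; last by rewrite mulg1.
by have /subgroupP[] := (lower_central_series_normal G c.+1).1.
Qed.
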